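(* Let $Y$ be a closed invariant set of a nonsingular flow $\Phi$ on a closed hyperbolic $3$-manifold $M$, let $\widetilde\Phi$ be the lifted flow on the universal cover $\mathbf H^3$ and let $\widetilde Y\subset\mathbf H^3$ be the lift (full preimage) of $Y$. Suppose that: (a) half orbits converge: for any $x\in\widetilde Y$ each of the two rays of $x\cdot\mathbf R$ accumulates in a single point of $S^2_\infty$, that is, the limits $\lim_{t\to+\infty}x\cdot t=\eta_+(x)\in S^2_\infty$ and $\lim_{t\to-\infty}x\cdot t=\eta_-(x)\in S^2_\infty$ exist; (b) for each $x\in\widetilde Y$, $\eta_+(x)\neq\eta_-(x)$; (c) the maps $\eta_+,\eta_-:\widetilde Y\to S^2_\infty$ are continuous. Then the orbits of $\widetilde\Phi|_{\widetilde Y}$ are uniformly quasigeodesic: there is $k>0$ so that for any orbit $\gamma$ of $\widetilde\Phi$ in $\widetilde Y$ and any $x,y\in\gamma$, $\tau(x,y)<k\,d(x,y)+k$.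
   Context: $S^2_\infty$ is the sphere at infinity of $\mathbf H^3$; limits are taken in $\mathbf H^3\cup S^2_\infty\approx B^3$. Flows are continuous $\mathbf R$-actions generated by nonzero continuous vector fields; flow lines are parameterized by arc length. $x\cdot t=\widetilde\Phi_t(x)$ and $x\cdot\mathbf R$ is the orbit of $x$. If $y=x\cdot t$ then $\tau(x,y)=|t|$. $d$ is hyperbolic distance. *)

(* Defs.v *)
From mathcomp Require Import all_boot all_order all_algebra.
From mathcomp Require Import all_classical all_reals all_analysis.

Set Implicit Arguments.
Unset Strict Implicit.
Unset Printing Implicit Defensive.

Import Order.TTheory GRing.Theory Num.Theory.
Import numFieldNormedType.Exports.

Local Open Scope classical_set_scope.
Local Open Scope ring_scope.

(* Hyperbolic 3-space is the Poincare ball model, so that its compactification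
   by the sphere at infinity is literally the closed unit ball of R^3.
   The library norm on 'rV[R]_3 is the sup norm (with the same topology), hence
   the explicit Euclidean norm below. *)

Definition sqnorm (R : realType) (u : 'rV[R]_3) : R := \sum_i u 0 i ^+ 2.

Definition enorm (R : realType) (u : 'rV[R]_3) : R := Num.sqrt (sqnorm u).

(* Used as a type through the coercion set_type, with the induced topology. *)
Definition H3 (R : realType) : set 'rV[R]_3 := [set u | enorm u < 1].

Arguments H3 R _ : clear implicits.

Definition S2oo (R : realType) : set 'rV[R]_3 := [set u | enorm u = 1].

Definition coord (R : realType) (x : H3 R) : 'rV[R]_3 := set_val x.

Definition arcosh (R : realType) (z : R) : R := ln (z + Num.sqrt (z ^+ 2 - 1)).

(* The distance of the Riemannian metric 4 |dx|^2 / (1 - |x|^2)^2. *)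
Definition hdist (R : realType) (x y : H3 R) : R :=
  arcosh (1 + 2 * sqnorm (coord x - coord y) /
              ((1 - sqnorm (coord x)) * (1 - sqnorm (coord y)))).

(* Riemannian length of the tangent vector v at x. *)
Definition hnorm (R : realType) (x : H3 R) (v : 'rV[R]_3) : R :=
  2 * enorm v / (1 - sqnorm (coord x)).

Record isometry_group (R : realType) (G : set (H3 R -> H3 R)) : Prop := {
  isog_id : G id;
  isog_comp : forall g h, G g -> G h -> G (g \o h);
  isog_inv : forall g, G g -> exists h, [/\ G h, cancel g h & cancel h g];
  isog_isometry : forall g, G g -> forall x y, hdist (g x) (g y) = hdist x y }.

(* M is the closed hyperbolic 3-manifold H^3 / G, with universal covering
   projection p and group of deck transformations G. *)
Record closed_hyperbolic_3manifold (R : realType) (M : topologicalType)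
    (G : set (H3 R -> H3 R)) (p : H3 R -> M) : Prop := {
  chm_group : isometry_group G;
  chm_free : forall g x, G g -> g x = x -> g = id;
  chm_proper : forall K : set (H3 R), compact K ->
    finite_set [set g | G g /\ (g @` K) `&` K !=set0];
  chm_surj : forall m : M, exists x, p x = m;
  chm_fiber : forall x y, p x = p y <-> exists2 g, G g & g x = y;
  chm_topology : forall U : set M, open U <-> open (p @^-1` U);
  chm_compact : compact [set: M] }.

Record is_flow (R : realType) (X : topologicalType) (Phi : R -> X -> X) : Prop := {
  flow_continuous : continuous (fun tx : R * X => Phi tx.1 tx.2);
  flow0 : forall x, Phi 0 x = x;
  flowD : forall s t x, Phi (s + t) x = Phi s (Phi t x) }.

Definition flow_invariant (R : realType) (X : Type) (Phi : R -> X -> X)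
    (Y : set X) : Prop :=
  forall t x, Y x -> Y (Phi t x).

Definition lifted_flow (R : realType) (M : topologicalType) (p : H3 R -> M)
    (Phi : R -> M -> M) (tPhi : R -> H3 R -> H3 R) : Prop :=
  is_flow tPhi /\ forall t x, p (tPhi t x) = Phi t (p x).

(* V is the lift to H^3 of the generating vector field on M: since tPhi lifts a
   flow on M it commutes with the deck transformations, so its velocity field V
   is automatically invariant under them. *)
Record generated_by (R : realType) (tPhi : R -> H3 R -> H3 R)
    (V : H3 R -> 'rV[R]_3) : Prop := {
  gen_continuous : continuous V;
  gen_nonzero : forall x, V x != 0;
  gen_derive : forall x t,
    is_derive (t : R) 1 (fun s : R => coord (tPhi s x)) (V (tPhi t x)) }.

Definition arclength_parametrized (R : realType) (V : H3 R -> 'rV[R]_3) : Prop :=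
  forall x, hnorm x (V x) = 1.

Definition eta_plus (R : realType) (tPhi : R -> H3 R -> H3 R) (x : H3 R)
  : 'rV[R]_3 := lim (coord (tPhi t x) @[t --> +oo]).

Definition eta_minus (R : realType) (tPhi : R -> H3 R -> H3 R) (x : H3 R)
  : 'rV[R]_3 := lim (coord (tPhi t x) @[t --> -oo]).

(* `lim` is only meaningful when the limit exists, hence the convergence
   clauses. *)
Definition half_orbits_converge (R : realType) (tPhi : R -> H3 R -> H3 R)
    (tY : set (H3 R)) : Prop :=
  forall x, tY x ->
    [/\ coord (tPhi t x) @[t --> +oo] --> eta_plus tPhi x,
        S2oo (eta_plus tPhi x),
        coord (tPhi t x) @[t --> -oo] --> eta_minus tPhi x
      & S2oo (eta_minus tPhi x)].

Definition orbit_of (R : realType) (X : Type) (Phi : R -> X -> X) (x : X) : set X :=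
  [set Phi t x | t in [set: R]].

(* The time t with y = x . t is quantified universally; `|t| is tau(x, y). *)
Definition uniformly_quasigeodesic (R : realType) (tPhi : R -> H3 R -> H3 R)
    (tY : set (H3 R)) : Prop :=
  exists2 k : R, 0 < k &
    forall z, tY z -> forall x y, orbit_of tPhi z x -> orbit_of tPhi z y ->
    forall t, y = tPhi t x -> `|t| < k * hdist x y + k.

(* Main.v *)
(* Let xi be the backward endpoint of the orbit of x, B the Busemann function of
   xi, and c(x, t) = B (x.t) - B x.  This is an additive cocycle of the flow on
   the lift of Y, bounded up to a constant by d(x, x.t), and it tends to +oo with
   t because x.t converges to a boundary point other than xi.  It is a limit of
   differences of distances from x.t and x to x.s as s -> -oo, so it is invariant
   under deck transformations, with no need to extend these to the sphere at
   infinity.  By continuity of the backward endpoint map and compactness of M,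
   there is T such that every x has a time s in [1, T] with c(x, s) > ln 2;
   iterating, c(x, t), and with it d(x, x.t), grows at least linearly in t. *)
Require Import Defs.
From mathcomp Require Import all_boot all_order all_algebra.
From mathcomp Require Import all_classical all_reals all_analysis.
From mathcomp Require Import ring lra.
Import Order.TTheory GRing.Theory Num.Theory.
Import numFieldNormedType.Exports.
Local Open Scope classical_set_scope.
Local Open Scope ring_scope.

(* [coord] alone would be the coordinate function of vector.v. *)
Local Notation coord := Defs.coord.

(** * Estimates in the Poincare ball *)

Section Hyperbolic.
Context {R : realType}.
Implicit Types (u v : 'rV[R]_3) (x y z : H3 R).

Lemma sqnormE u :
  sqnorm u = u 0 0 ^+ 2 + u 0 1 ^+ 2 + u 0 (inord 2) ^+ 2.
Proof.
rewrite /sqnorm !big_ord_recr big_ord0 /= add0r.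
by congr (_ + _ + _); congr (u _ _ ^+ 2); apply/val_inj; rewrite //= inordK.
Qed.

Lemma sqnorm_ge0 u : 0 <= sqnorm u.
Proof. by apply: sumr_ge0 => i _; exact: sqr_ge0. Qed.

Lemma sqnorm_eq0 u : (sqnorm u == 0) = (u == 0).
Proof.
apply/eqP/eqP => [u0|->]; last first.
  by rewrite /sqnorm big1 // => i _; rewrite mxE expr0n.
apply/rowP => i; rewrite mxE; apply/eqP; rewrite -sqrf_eq0; apply/eqP.
by apply: (psumr_eq0P (fun i _ => sqr_ge0 (u 0 i)) u0).
Qed.

Lemma sqnormB u v : sqnorm (u - v) = sqnorm (v - u).
Proof. by apply: eq_bigr => i _; rewrite !mxE -sqrrN opprB. Qed.

Lemma sqnorm_triangle u v w :
  sqnorm (u - w) <= 2 * sqnorm (u - v) + 2 * sqnorm (v - w).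
Proof.
rewrite !sqnormE !mxE -subr_ge0.
rewrite [leRHS](_ : _ = (u 0 0 - 2 * v 0 0 + w 0 0) ^+ 2
  + (u 0 1 - 2 * v 0 1 + w 0 1) ^+ 2
  + (u 0 (inord 2) - 2 * v 0 (inord 2) + w 0 (inord 2)) ^+ 2); last by ring.
by rewrite !addr_ge0 ?sqr_ge0.
Qed.

Lemma sqr_subr_sqnorm_le u v : sqnorm u <= 1 -> sqnorm v <= 1 ->
  (sqnorm u - sqnorm v) ^+ 2 <= 4 * sqnorm (u - v).
Proof.
move=> u1 v1.
(* Cauchy-Schwarz for [u - v] and [u + v], whose inner product is [sqnorm u - sqnorm v]; the defect
   is a sum of squares by Lagrange's identity. *)
have CS : (sqnorm u - sqnorm v) ^+ 2 <= sqnorm (u - v) * sqnorm (u + v).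
  rewrite !sqnormE !mxE -subr_ge0.
  set a := u 0 0; set b := u 0 1; set c := u 0 (inord 2).
  set a' := v 0 0; set b' := v 0 1; set c' := v 0 (inord 2).
  rewrite [leRHS](_ : _ = ((a - a') * (b + b') - (b - b') * (a + a')) ^+ 2
    + ((a - a') * (c + c') - (c - c') * (a + a')) ^+ 2
    + ((b - b') * (c + c') - (c - c') * (b + b')) ^+ 2); last by ring.
  by rewrite !addr_ge0 ?sqr_ge0.
apply: (le_trans CS); rewrite mulrC ler_wpM2r ?sqnorm_ge0//.
have := sqnorm_triangle u 0 (- v); rewrite !subr0 sub0r !opprK => h.
by apply: (le_trans h); lra.
Qed.

Lemma sqnorm_continuous : continuous (@sqnorm R).
Proof.
move=> u; rewrite (_ : @sqnorm R = fun u => u 0 0 * u 0 0 + u 0 1 * u 0 1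
    + u 0 (inord 2) * u 0 (inord 2)); last first.
  by apply/funext => v; rewrite sqnormE !expr2.
have c i : {for u, continuous (fun u : 'rV[R]_3 => u 0 i * u 0 i)}.
  have ci : {for u, continuous (fun u : 'rV[R]_3 => u 0 i)} by exact: coord_continuous.
  exact: (cvgM ci ci).
exact: (cvgD (cvgD (c _) (c _)) (c _)).
Qed.

Lemma H3_lt1 x : sqnorm (coord x) < 1.
Proof.
have : H3 R (coord x) by exact: set_valP.
by rewrite /H3 /= /enorm -{1}sqrtr1 ltr_sqrt.
Qed.

Lemma S2oo_sqnorm u : S2oo u -> sqnorm u = 1.
Proof.
by rewrite /S2oo /= /enorm => u1; rewrite -(sqr_sqrtr (sqnorm_ge0 u)) u1 expr1n.
Qed.

Definition conf x : R := 1 - sqnorm (coord x).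

Lemma conf_gt0 x : 0 < conf x.
Proof. by rewrite subr_gt0 H3_lt1. Qed.

Lemma conf_le1 x : conf x <= 1.
Proof. by rewrite lerBlDr lerDl sqnorm_ge0. Qed.

(** This is cosh of the hyperbolic distance: [hdist x y] unfolds to [arcosh (hcosh x y)]. Estimates
    and limits are carried out on this rational expression. *)
Definition hcosh x y : R :=
  1 + 2 * sqnorm (coord x - coord y) / (conf x * conf y).

Lemma hcosh_ge1 x y : 1 <= hcosh x y.
Proof.
rewrite lerDl divr_ge0 ?mulr_ge0 ?sqnorm_ge0//; exact/ltW/conf_gt0.
Qed.

Lemma hcoshC x y : hcosh x y = hcosh y x.
Proof. by rewrite /hcosh sqnormB (mulrC (conf x)). Qed.

Lemma hcoshxx x : hcosh x x = 1.
Proof.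
by rewrite /hcosh subrr (eqP (etrans (sqnorm_eq0 0) (eqxx 0))) mulr0 mul0r addr0.
Qed.

(* exp (B_xi x), for B_xi the Busemann function of the boundary point xi. *)
Definition horo (xi : 'rV[R]_3) x : R := sqnorm (coord x - xi) / conf x.

Section Limits.
Context {T : Type} {F : set_system T} {FF : Filter F}.
Implicit Types (f g : T -> H3 R).

Lemma cvg_sqnorm (h : T -> 'rV[R]_3) u :
  h @ F --> u -> sqnorm (h t) @[t --> F] --> sqnorm u.
Proof. by move=> hu; apply: (cvg_comp h _ hu); exact: sqnorm_continuous. Qed.

Lemma cvg_coord f x : f @ F --> x -> coord (f t) @[t --> F] --> coord x.
Proof. by move=> fx; apply: (cvg_comp f _ fx); exact: initial_continuous. Qed.

Lemma cvg_conf f u : coord (f t) @[t --> F] --> u ->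
  conf (f t) @[t --> F] --> 1 - sqnorm u.
Proof. by move=> /cvg_sqnorm; apply: cvgB; exact: cvg_cst. Qed.

Lemma cvg_hcosh f g x y : f @ F --> x -> g @ F --> y ->
  hcosh (f t) (g t) @[t --> F] --> hcosh x y.
Proof.
move=> /cvg_coord fx /cvg_coord gy.
have N : 2 * sqnorm (coord (f t) - coord (g t)) @[t --> F]
    --> 2 * sqnorm (coord x - coord y).
  by apply: cvgM; [exact: cvg_cst|apply: cvg_sqnorm; exact: cvgB].
have D : (conf (f t) * conf (g t))^-1 @[t --> F] --> (conf x * conf y)^-1.
  apply: cvgV; first by rewrite mulf_neq0 ?gt_eqF ?conf_gt0.
  by apply: cvgM; exact: cvg_conf.
by apply: cvgD; [exact: cvg_cst|exact: (cvgM N D)].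
Qed.

Lemma cvg_horo (h : T -> 'rV[R]_3) f xi x : h @ F --> xi -> f @ F --> x ->
  horo (h t) (f t) @[t --> F] --> horo xi x.
Proof.
move=> hxi /cvg_coord fx; apply: cvgM; first by apply: cvg_sqnorm; exact: cvgB.
by apply: cvgV; [rewrite gt_eqF ?conf_gt0|exact: cvg_conf].
Qed.

Lemma cvg_hcoshr x g y : g @ F --> y -> hcosh x (g t) @[t --> F] --> hcosh x y.
Proof. by apply: cvg_hcosh; exact: cvg_cst. Qed.

End Limits.

Lemma expR_arcosh (c : R) : 1 <= c -> expR (arcosh c) = c + Num.sqrt (c ^+ 2 - 1).
Proof.
move=> c1; rewrite lnK// posrE.
by apply: ltr_wpDr; [exact: sqrtr_ge0|exact: lt_le_trans c1].
Qed.

Lemma arcosh_inj (a b : R) : 1 <= a -> 1 <= b -> arcosh a = arcosh b -> a = b.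
Proof.
(* The formula cosh d = (e^d + e^-d) / 2 recovers [c] from its [arcosh]. *)
suff H (c : R) : 1 <= c -> c = (expR (arcosh c) ^+ 2 + 1) / (2 * expR (arcosh c)).
  by move=> a1 b1 ab; rewrite (H b b1) -ab; exact: H.
move=> c1; have e0 := expR_gt0 (arcosh c).
apply/(canRL (mulfK _)); first by rewrite mulf_neq0 ?gt_eqF.
have /sqr_sqrtr : 0 <= c ^+ 2 - 1 by rewrite subr_ge0 exprn_ege1.
rewrite expR_arcosh//; set s := Num.sqrt _ => hs.
have -> : (c + s) ^+ 2 = c ^+ 2 + 2 * (c * s) + s ^+ 2 by ring.
rewrite hs; ring.
Qed.

(** This is cosh d <= e^d; it turns multiplicative bounds on [hcosh] into additive ones on
    [hdist]. *)
Lemma ln_hcosh_le x y : ln (hcosh x y) <= hdist x y.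
Proof.
have h1 := hcosh_ge1 x y.
rewrite -ler_expR lnK ?posrE ?(lt_le_trans _ h1)//.
by rewrite expR_arcosh// lerDl sqrtr_ge0.
Qed.

Lemma hdistC x y : hdist x y = hdist y x.
Proof. by congr arcosh; exact: hcoshC. Qed.

Lemma hcosh_isometry {g : H3 R -> H3 R} :
  (forall x y, hdist (g x) (g y) = hdist x y) ->
  forall x y, hcosh (g x) (g y) = hcosh x y.
Proof.
by move=> gd x y; apply: arcosh_inj; rewrite ?hcosh_ge1//; exact: gd.
Qed.

(** As [conf] is at most 1, [hcosh x y - 1] dominates the square of every coordinate of x - y.
    Hyperbolic balls thus refine the induced topology, which makes distance-preserving maps
    continuous. *)
Lemma nbhs_hcosh x (B : set (H3 R)) : nbhs x B ->
  exists2 e, 0 < e & forall y, hcosh x y < 1 + e -> B y.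
Proof.
move=> [_ /= [[W oW <-] Wx] WB].
have /nbhs_ballP[d /= d0 dW] : nbhs (coord x) W by exact: open_nbhs_nbhs.
exists (d ^+ 2); first by rewrite exprn_gt0.
move=> y; rewrite ltrD2l => xy; apply: WB; apply: dW; split=> // i j.
rewrite /ball /= -(@ltr_pXn2r _ 2) ?nnegrE ?normr_ge0 ?(ltW d0)//.
rewrite real_normK ?num_real//; apply: le_lt_trans xy.
rewrite ord1 ler_pdivlMr ?mulr_gt0 ?conf_gt0//.
apply: (@le_trans _ _ ((coord x 0 j - coord y 0 j) ^+ 2)).
  rewrite ler_piMr ?sqr_ge0// mulr_ile1 ?conf_le1//; exact/ltW/conf_gt0.
apply: (@le_trans _ _ (sqnorm (coord x - coord y))).
  rewrite /sqnorm (bigD1 j)//= !mxE lerDl sumr_ge0// => k _; exact: sqr_ge0.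
by rewrite ler_peMl ?sqnorm_ge0// ler1n.
Qed.

Lemma isometry_continuous {g : H3 R -> H3 R} :
  (forall x y, hdist (g x) (g y) = hdist x y) -> continuous g.
Proof.
move=> gd x B /nbhs_hcosh[e e0 eB].
have : hcosh x y @[y --> x] --> hcosh x x.
  by apply: (@cvg_hcoshr _ (nbhs x) (nbhs_filter x) x id x) => /= A.
rewrite hcoshxx => /(@cvgr_lt _ _ _ (nbhs_filter x) _ 1)/(_ (1 + e)).
rewrite ltrDl => /(_ e0); apply: filterS => y xy.
by apply: eB; rewrite (hcosh_isometry gd).
Qed.

(** * Busemann functions of boundary points *)

Lemma sqnormB_boundary_gt0 xi x : S2oo xi -> 0 < sqnorm (coord x - xi).
Proof.
move=> /S2oo_sqnorm xi1; rewrite lt_neqAle sqnorm_ge0 andbT eq_sym sqnorm_eq0.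
by apply/eqP => /subr0_eq x1; have := H3_lt1 x; rewrite x1 xi1 ltxx.
Qed.

Lemma horo_gt0 xi x : S2oo xi -> 0 < horo xi x.
Proof. by move=> xi1; rewrite divr_gt0 ?conf_gt0 ?sqnormB_boundary_gt0. Qed.

(** Multiplicative form of the Lipschitz bound B y - B x <= d(x, y), up to an additive constant; the
    crude factor 8 leaves room for elementary inequalities. *)
Lemma horo_le xi x y : S2oo xi -> horo xi y <= 8 * hcosh x y * horo xi x.
Proof.
move=> xiS; have xi1 := S2oo_sqnorm _ xiS.
have N0 := sqnormB_boundary_gt0 _ x xiS.
have a0 := conf_gt0 x; have b0 := conf_gt0 y.
have tri := sqnorm_triangle (coord y) (coord x) xi.
have h1 : conf x ^+ 2 <= 4 * sqnorm (coord x - xi).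
  have xi_le1 : sqnorm xi <= 1 by rewrite xi1.
  have := sqr_subr_sqnorm_le (coord x) xi (ltW (H3_lt1 x)) xi_le1.
  by rewrite xi1 -sqrrN opprB.
have h2 : (conf x - conf y) ^+ 2 <= 4 * sqnorm (coord y - coord x).
  have := sqr_subr_sqnorm_le (coord y) (coord x) (ltW (H3_lt1 y)) (ltW (H3_lt1 x)).
  by rewrite /conf; congr (_ ^+ 2 <= _); ring.
rewrite /horo /hcosh (sqnormB (coord x) (coord y)).
set N := sqnorm (coord x - xi) in tri N0 h1 *.
set D := sqnorm (coord y - coord x) in tri h2 *.
have D0 : 0 <= D by exact: sqnorm_ge0.
set a := conf x in a0 h1 h2 *; set b := conf y in b0 h2 *.
rewrite (_ : 8 * _ * _ = (8 * a * b * N + 16 * D * N) / (a ^+ 2 * b)); last first.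
  by field; rewrite !gt_eqF.
(* The claim with denominators cleared. After the triangle inequality, the term D a^2 is bounded
   through a^2 <= 4 N, and N a^2 through a^2 <= 2 a b + 4 D. *)
have key : sqnorm (coord y - xi) * a ^+ 2 <= 8 * a * b * N + 16 * D * N.
  apply: (@le_trans _ _ ((2 * D + 2 * N) * a ^+ 2)).
    by rewrite ler_wpM2r ?sqr_ge0.
  have h3 : a ^+ 2 <= 2 * (a * b) + 4 * D by nra.
  have h4 : 0 <= D * (4 * N - a ^+ 2) by rewrite mulr_ge0// subr_ge0.
  have h5 : 0 <= N * (2 * (a * b) + 4 * D - a ^+ 2).
    by rewrite mulr_ge0 ?(ltW N0)// subr_ge0.
  have h6 : 0 <= N * (a * b) by rewrite !mulr_ge0// ltW.
  by lra.
rewrite ler_pdivlMr ?mulr_gt0 ?exprn_gt0//.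
by rewrite (_ : _ / b * _ = sqnorm (coord y - xi) * a ^+ 2)//; field; rewrite gt_eqF.
Qed.


(** The cosh of the distance blows up at the boundary at the rate 1 / [conf]; the renormalized limit
    is the exponential of the Busemann function. *)
Lemma cvg_hcosh_boundary {T : Type} {F : set_system T} {FF : Filter F}
    (f : T -> H3 R) (xi : 'rV[R]_3) x :
  S2oo xi -> coord (f t) @[t --> F] --> xi ->
  hcosh x (f t) * conf (f t) @[t --> F] --> 2 * horo xi x.
Proof.
move=> /S2oo_sqnorm xi1 fxi.
have -> : (fun t => hcosh x (f t) * conf (f t)) =
    fun t => conf (f t) + 2 / conf x * sqnorm (coord x - coord (f t)).
  apply/funext => t; rewrite /hcosh; field.
  by rewrite !gt_eqF ?conf_gt0.
have -> : 2 * horo xi x = (1 - sqnorm xi) + 2 / conf x * sqnorm (coord x - xi).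
  by rewrite /horo xi1; field; rewrite gt_eqF ?conf_gt0.
apply: cvgD; first exact: cvg_conf.
apply: cvgM; first exact: cvg_cst.
by apply: cvg_sqnorm; apply: cvgB; [exact: cvg_cst|].
Qed.

(** Ratios of [horo] are limits of ratios of [hcosh], which [g] preserves. The point [xi'] acts as
    the image of [xi], known only as the limit of g (f t). *)
Lemma horo_isometry {T : Type} {F : set_system T} {FF : ProperFilter F}
    (g : H3 R -> H3 R) (f : T -> H3 R) (xi xi' : 'rV[R]_3) x y :
  (forall x y, hdist (g x) (g y) = hdist x y) ->
  S2oo xi -> coord (f t) @[t --> F] --> xi ->
  S2oo xi' -> coord (g (f t)) @[t --> F] --> xi' ->
  horo xi' (g y) * horo xi x = horo xi' (g x) * horo xi y.
Proof.
move=> gd xiS fxi xiS' fxi'.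
(* In the products for (y, x) and (x, y) the [conf] factors are the same and the [hcosh] factors are
   exchanged, so the two limits agree. *)
have lim (u v : H3 R) :
    (hcosh (g u) (g (f t)) * conf (g (f t))) * (hcosh v (f t) * conf (f t))
      @[t --> F] --> (2 * horo xi' (g u)) * (2 * horo xi v).
  by apply: cvgM; exact: cvg_hcosh_boundary.
have yx := lim y x; have xy := lim x y.
have E :
    (fun t => (hcosh (g y) (g (f t)) * conf (g (f t))) * (hcosh x (f t) * conf (f t)))
  = (fun t => (hcosh (g x) (g (f t)) * conf (g (f t))) * (hcosh y (f t) * conf (f t))).
  by apply/funext => t; rewrite !(hcosh_isometry gd); ring.
rewrite E in yx.
have four_neq0 : (4 : R) != 0 by rewrite pnatr_eq0.
have four a b : 4 * (a * b) = (2 * a) * (2 * b) :> R by ring.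
apply: (mulfI four_neq0); rewrite !four.
exact: (cvg_unique (@Rhausdorff R) yx xy).
Qed.

Lemma horo_pinfty {T : Type} {F : set_system T} {FF : Filter F}
    (f : T -> H3 R) (xi xi' : 'rV[R]_3) (K : R) :
  S2oo xi' -> xi' <> xi -> coord (f t) @[t --> F] --> xi' ->
  \forall t \near F, K < horo xi (f t).
Proof.
move=> /S2oo_sqnorm xi1 xixi fxi.
(* The inequality K < [horo] is multiplied by [conf], so that only finite limits occur: [conf] tends
   to 0 while the numerator stays away from 0. *)
have lim : sqnorm (coord (f t) - xi) - K * conf (f t) @[t --> F] -->
    sqnorm (xi' - xi) - K * (1 - sqnorm xi').
  apply: cvgB; first exact: (cvg_sqnorm _ _ (cvgB fxi (cvg_cst xi))).
  exact: (cvgM (cvg_cst K) (cvg_conf _ _ fxi)).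
have pos : 0 < sqnorm (xi' - xi) - K * (1 - sqnorm xi').
  rewrite xi1 subrr mulr0 subr0 lt_neqAle sqnorm_ge0 andbT eq_sym sqnorm_eq0 subr_eq0.
  exact/eqP.
apply: filterS (cvgr_gt _ lim _ pos) => t.
by rewrite subr_gt0 ltr_pdivlMr ?conf_gt0.
Qed.

End Hyperbolic.

Lemma cvg_flow {R : realType} {X : topologicalType} {Phi : R -> X -> X}
    {T : Type} {F : set_system T} {FF : Filter F} (f : T -> R) (g : T -> X) t x :
  is_flow Phi -> f @ F --> t -> g @ F --> x -> Phi (f s) (g s) @[s --> F] --> Phi t x.
Proof.
move=> flow ft gx.
apply: (cvg_comp (fun s => (f s, g s)) (fun sx : R * X => Phi sx.1 sx.2)).
  exact: (cvg_pair ft gx).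
have flow_cont : continuous (fun sx : R * X => Phi sx.1 sx.2).
  exact: flow_continuous flow.
exact: (flow_cont (t, x)).
Qed.

Lemma flow_continuous_time {R : realType} {X : topologicalType} {Phi : R -> X -> X} x :
  is_flow Phi -> continuous (Phi^~ x).
Proof. by move=> flow t; apply: (cvg_flow id (fun=> x)) => //; exact: cvg_cst. Qed.

(** * Deck transformations, cocompactness and the lifted flow *)

Section Covering.
Context {R : realType} {M : topologicalType} {G : set (H3 R -> H3 R)} {p : H3 R -> M}.
Hypothesis hM : closed_hyperbolic_3manifold G p.

Lemma deck_continuous {g} : G g -> continuous g.
Proof. by move=> /(isog_isometry (chm_group hM)); exact: isometry_continuous. Qed.

Lemma deck_fiber {g} x : G g -> p (g x) = p x.
Proof. by move=> Gg; apply/esym; apply/(chm_fiber hM); exists g. Qed.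

Lemma deck_eq g h x : G g -> G h -> g x = h x -> g = h.
Proof.
move=> Gg Gh ghx; have [k [Gk gk kg]] := isog_inv (chm_group hM) Gg.
have khx : (k \o h) x = x by rewrite /= -ghx gk.
have khid := chm_free hM (isog_comp (chm_group hM) Gk Gh) khx.
by apply/funext => y; rewrite -[h y]kg -[k (h y)]/((k \o h) y) khid.
Qed.

Lemma covering_continuous : continuous p.
Proof. by apply/continuousP => U; rewrite (chm_topology hM). Qed.

Lemma covering_open U : open U -> open (p @` U).
Proof.
move=> oU; apply/(chm_topology hM).
have -> : p @^-1` (p @` U) = \bigcup_(g in G) (g @^-1` U).
  apply/seteqP; split => [x [y Uy] /esym/(chm_fiber hM)[g Gg gx]|x [g Gg Ugx]].
    by exists g => //=; rewrite gx.
  by exists (g x) => //; exact: deck_fiber.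
apply: bigcup_open => g Gg; apply: open_comp => // x _; exact: deck_continuous.
Qed.

(** The interiors of the [A n] project to an increasing open cover of M, so one of them suffices by
    compactness; invariance carries the property back to every point of a fiber. *)
Lemma cocompact_uniform (A : nat -> set (H3 R)) :
  (forall m n, (m <= n)%N -> A m `<=` A n) ->
  (forall n g x, G g -> A n (g x) -> A n x) ->
  (forall x : H3 R, exists n, nbhs x (A n)) ->
  exists n, forall x, A n x.
Proof.
move=> mono inv loc.
have := chm_compact hM; rewrite compact_near_coveringP.
move=> /(_ nat \oo (fun n m => (p @` A n) m) _)[].
  move=> m _; have [x <-] := chm_surj hM m; have [n nA] := loc x.
  exists (p @` (A n)°, [set k | (n <= k)%N]).
    split => /=; last by exists n.
    by apply: open_nbhs_nbhs; split; [exact/covering_open/open_interior|exists x].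
  move=> [y k] /= [[z /interior_subset Az <-] nk]; exists z => //.
  exact: mono nk _ Az.
move=> n _ /(_ n (leqnn n)) cover; exists n => x.
have [y Ay /esym/(chm_fiber hM)[g Gg gxy]] := cover (p x) I.
by apply: (inv _ g) => //; rewrite gxy.
Qed.

(* Phi lifts the flow on M, so for each time some deck transformation carries
   Phi t x to Phi t (g x); by proper discontinuity finitely many occur on a
   compact time interval, and freeness makes the corresponding closed sets of
   times disjoint, so connectedness leaves only g. *)
Lemma lifted_flow_equivariant {Phi tPhi} : lifted_flow p Phi tPhi ->
  forall g t x, G g -> tPhi t (g x) = g (tPhi t x).
Proof.
move=> [flow lift] g t x Gg.
(* A symmetric interval contains both 0 and t, whatever the sign of t. *)
pose I := `[(- `|t|)%R, `|t|]%classic.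
have bc := flow_continuous_time x flow; have ac := flow_continuous_time (g x) flow.
pose K := (tPhi^~ x @` I) `|` (tPhi^~ (g x) @` I).
have Kc : compact K.
  by apply: compactU; apply: continuous_compact (@segment_compact _ _ _);
    exact: continuous_subspaceT.
have closed_agree h : G h -> closed [set s | h (tPhi s x) = tPhi s (g x)].
  move=> Gh.
  have -> : [set s | h (tPhi s x) = tPhi s (g x)] =
      (fun s => sqnorm (coord (h (tPhi s x)) - coord (tPhi s (g x))))
        @^-1` [set r | r = 0].
    apply/seteqP; split => s /=.
      by move=> ->; rewrite subrr; apply/eqP; rewrite sqnorm_eq0.
    move=> /eqP; rewrite sqnorm_eq0 subr_eq0 => /eqP; rewrite /coord !set_valE.
    exact: val_inj.
  apply: preimage_closed (@closed_eq _ 0) => s _.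
  apply: cvg_sqnorm; apply: cvgB; apply: cvg_coord; last exact: ac.
  apply: (cvg_comp (tPhi^~ x) h); [exact: bc|exact: deck_continuous].
(* The finitely many competitors of [g]; the times at which one of them occurs form the closed set
   [C]. *)
pose D := [set h | G h /\ (h @` K) `&` K !=set0] `\ g.
have Dfin : finite_set D by exact: finite_setD (chm_proper hM Kc).
pose C := \bigcup_(h in D) [set s | h (tPhi s x) = tPhi s (g x)].
have Cc : closed C by apply: closed_bigcup => // h [[Gh _] _]; exact: closed_agree.
suff : I `&` [set s | g (tPhi s x) = tPhi s (g x)] = I.
  move=> /seteqP[_ IS]; apply/esym.
  have [] // := IS t; rewrite /I /= in_itv/= ler_norm andbT.
  by rewrite lerNl -normrN ler_norm.
(* The set of good times is nonempty because of time 0, relatively open as the complement of [C] in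
   [I], and relatively closed. *)
apply: (@segment_connected R (- `|t|) `|t|).
- exists 0; split; first by rewrite /I /= in_itv/= oppr_le0 normr_ge0.
  by rewrite /= !(flow0 flow).
- exists (~` C); first by rewrite openC.
  apply/seteqP; split => s [Is]; last first.
    move=> nCs; split=> //=.
    have /(chm_fiber hM)[h Gh hE] : p (tPhi s x) = p (tPhi s (g x)).
      by rewrite !lift deck_fiber.
    have [hg|hg] := pselect (h = g); first by rewrite -{1}hg.
    case: nCs; exists h => //; split; last exact: hg.
    split=> //.
    exists (tPhi s (g x)); split; last by right; exact: imageP.
    by exists (tPhi s x) => //; left; exact: imageP.
  move=> /= gs; split=> // -[h [[Gh _] hg] /= hs].
  by apply: hg; apply: (deck_eq _ _ (tPhi s x) Gh Gg); rewrite hs gs.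
- by exists [set s | g (tPhi s x) = tPhi s (g x)]; first exact: closed_agree.
Qed.

End Covering.

(** * The Busemann cocycle and its exponential growth *)

Section Growth.
Context {R : realType} {M : topologicalType} {G : set (H3 R -> H3 R)} {p : H3 R -> M}.
Context {Phi : R -> M -> M} {tPhi : R -> H3 R -> H3 R} {Y : set M}.
Hypotheses (hM : closed_hyperbolic_3manifold G p) (lift : lifted_flow p Phi tPhi).
Hypotheses (Y_closed : closed Y) (Y_inv : flow_invariant Phi Y).
Local Notation tY := (p @^-1` Y).
Local Notation eta := (eta_minus tPhi).
Hypotheses (conv : half_orbits_converge tPhi tY)
  (eta_neq : forall x, tY x -> eta_plus tPhi x <> eta x)
  (eta_cont : {within tY, continuous eta}).

Let flow : is_flow tPhi := proj1 lift.

Lemma lift_invariant t x : tY x -> tY (tPhi t x).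
Proof. by move=> Yx; rewrite /preimage /= (proj2 lift); exact: Y_inv. Qed.

Lemma lift_deck g x : G g -> tY x -> tY (g x).
Proof. by move=> Gg Yx; rewrite /preimage /= (deck_fiber hM). Qed.

Lemma eta_boundary x : tY x -> S2oo (eta x).
Proof. by move=> /conv[]. Qed.

Lemma eta_flow s x : tY x -> eta (tPhi s x) = eta x.
Proof.
move=> Yx; have [_ _ lims _] := conv _ (lift_invariant s _ Yx).
have [_ _ lim _] := conv _ Yx.
apply: (cvg_unique (@norm_hausdorff _ _) lims).
have shift : (fun t : R => t + s) @ -oo --> -oo.
  move=> P [m [mr mP]]; exists (m - s); split; first exact: num_real.
  by move=> t ts; apply: mP; rewrite -ltrBrDr.
have -> : (fun t => coord (tPhi t (tPhi s x))) =
    (fun t => coord (tPhi t x)) \o (fun t => t + s).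
  by apply/funext => t /=; rewrite (flowD flow).
exact: cvg_comp shift lim.
Qed.

(* The exponential of the Busemann cocycle of the flow, relative to the backward
   endpoint of the orbit. *)
Definition growth x t : R := horo (eta x) (tPhi t x) / horo (eta x) x.

Lemma growth_gt0 x t : tY x -> 0 < growth x t.
Proof. by move=> /eta_boundary etaS; rewrite divr_gt0// horo_gt0. Qed.

Lemma growthD s t x : tY x ->
  growth x (t + s) = growth x s * growth (tPhi s x) t.
Proof.
move=> Yx; rewrite /growth eta_flow// (flowD flow).
have etaS := eta_boundary _ Yx.
by field; rewrite !gt_eqF// horo_gt0.
Qed.

Lemma growth_deck g t x : G g -> tY x -> growth (g x) t = growth x t.
Proof.
move=> Gg Yx; have Ygx := lift_deck _ _ Gg Yx.
have [_ _ lim etaS] := conv _ Yx; have [_ _ limg etaSg] := conv _ Ygx.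
have equiv s y := lifted_flow_equivariant hM lift g s y Gg.
have limg' : coord (g (tPhi s x)) @[s --> -oo] --> eta (g x).
  by under eq_fun do rewrite -equiv.
have := horo_isometry g (tPhi^~ x) _ _ x (tPhi t x)
  (isog_isometry (chm_group hM) Gg) etaS lim etaSg limg'.
rewrite /growth equiv => E.
apply/eqP; rewrite eqr_div; [|by rewrite gt_eqF ?horo_gt0..].
by apply/eqP; rewrite [LHS]E mulrC.
Qed.

Lemma growth_le x t : tY x -> growth x t <= 8 * hcosh x (tPhi t x).
Proof.
by move=> /eta_boundary etaS; rewrite ler_pdivrMr ?horo_gt0// horo_le.
Qed.

(** The Lipschitz bound read from x.t back to x; it keeps [growth] away from 0 wherever the
    displacement is bounded. *)
Lemma growth_ge x t : tY x -> 1 <= 8 * hcosh x (tPhi t x) * growth x t.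
Proof.
move=> /eta_boundary etaS; rewrite mulrA ler_pdivlMr ?horo_gt0// mul1r.
by rewrite hcoshC horo_le.
Qed.

Lemma growth_continuous t x : tY x ->
  growth y t @[y --> within tY (nbhs x)] --> growth x t.
Proof.
move=> Yx.
have idc : id @ within tY (nbhs x) --> x by exact: cvg_within.
have /subspace_continuousP/(_ x Yx) etac := eta_cont.
have flowc : tPhi t y @[y --> within tY (nbhs x)] --> tPhi t x.
  by apply: (cvg_flow (fun=> t) id) => //; exact: cvg_cst.
apply: cvgM; first exact: cvg_horo.
apply: cvgV; last exact: (cvg_horo _ id).
by rewrite gt_eqF// horo_gt0//; exact: eta_boundary.
Qed.

(** Distinct endpoints give a doubling time for each single orbit, and cocompactness bounds it. The
    condition 1 <= s guarantees progress when doubling is iterated. *)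
Lemma uniform_doubling_time : exists n : nat, forall x, tY x ->
  exists2 s : R, 1 <= s <= n%:R & 2 < growth x s.
Proof.
apply: (cocompact_uniform hM
  (fun n => [set x | tY x -> exists2 s : R, 1 <= s <= n%:R & 2 < growth x s])).
- move=> m n mn x /= H /H[s /andP[s1 sm] gs]; exists s => //.
  by rewrite s1 (le_trans sm)// ler_nat.
- move=> n g x Gg /= H Yx; have [s sn gs] := H (lift_deck _ _ Gg Yx).
  by exists s => //; rewrite -(growth_deck g).
(* Outside the closed set [tY] the property holds vacuously on a neighbourhood. *)
move=> x; have [Yx|nYx] := pselect (tY x); last first.
  exists 0%N.
  have oC : open (~` tY).
    rewrite openC; apply: preimage_closed => // y _; exact: (covering_continuous hM).
  have : nbhs x (~` tY) by exact: open_nbhs_nbhs.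
  by apply: filterS => y nYy /= Yy; case: nYy.
have [limp etapS _ etaS] := conv _ Yx.
have late : \forall t \near +oo, 2 < growth x t.
  apply: filterS (horo_pinfty (tPhi^~ x) _ _ (2 * horo (eta x) x) etapS
    (eta_neq _ Yx) limp) => t late_t.
  by rewrite /growth ltr_pdivlMr ?horo_gt0.
have [s s1 gs] := pinfty_ex_ge (num_real 1) late.
exists (Num.bound s).
(* The same time s still works for nearby points of [tY], by continuity of the backward endpoint. *)
have gs_near : \forall y \near x, tY y -> 2 < growth y s.
  exact: (cvgr_gt _ (growth_continuous s _ Yx) _ gs).
apply: filterS gs_near => y H /= Yy; exists s; last exact: H.
by rewrite s1/= ltW// archi_boundP// (le_trans _ s1).
Qed.

(** Compactness of [0, T] gives a bound valid near each x, and cocompactness makes it global. *)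
Lemma uniform_displacement (T : R) : exists n : nat, forall x (s : R),
  0 <= s <= T -> hcosh x (tPhi s x) <= n%:R.
Proof.
apply: (cocompact_uniform hM
  (fun n => [set x | forall s : R, 0 <= s <= T -> hcosh x (tPhi s x) <= n%:R])).
- by move=> m n mn x /= H s /H xs; rewrite (le_trans xs)// ler_nat.
- move=> n g x Gg /= H s /H.
  rewrite (lifted_flow_equivariant hM lift)//.
  by rewrite (hcosh_isometry (isog_isometry (chm_group hM) Gg)).
move=> x.
have /compact_near_coveringP := @segment_compact R 0 T.
(* The product filter yields a neighbourhood of x and an integer bound at once, uniformly in s. *)
move=> /(_ _ (filter_prod (nbhs x) \oo)
  (fun yn s => hcosh yn.1 (tPhi s yn.1) <= yn.2%:R) _)[].
  move=> s _; pose c := hcosh x (tPhi s x); pose m := Num.bound (c + 1).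
  have cm : c < m%:R.
    have c1 : 0 <= c + 1 by rewrite addr_ge0// (le_trans ler01)// hcosh_ge1.
    by apply: lt_trans (archi_boundP c1); rewrite ltrDl.
  have lim : hcosh ry.2 (tPhi ry.1 ry.2) @[ry --> filter_prod (nbhs s) (nbhs x)] --> c.
    apply: cvg_hcosh; first exact: cvg_snd.
    by apply: cvg_flow => //; [exact: cvg_fst|exact: cvg_snd].
  have [[A B] /= [sA xB] AB] := cvgr_lt _ lim _ cm.
  exists (A, B `*` [set n | (m <= n)%N]) => /=.
    split=> //; exists (B, [set n | (m <= n)%N]) => //=.
    by split=> //; exists m.
  move=> [r [y n]] /= [Ar [By mn]].
  by rewrite (le_trans (ltW (AB (r, y) _)))//= ler_nat.
move=> [B N] /= [xB [m _ mN]] BN; exists m.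
apply: filterS xB => y By s sT.
by apply: (BN (y, m)) => //=; split=> //; exact: mN (leqnn m).
Qed.

Lemma exponential_growth : exists b c : R, [/\ 0 < b, 1 <= c &
  forall x t, tY x -> 0 <= t -> expR (t / b) <= c * hcosh x (tPhi t x)].
Proof.
have [n doubling] := uniform_doubling_time.
pose T : R := n.+1%:R.
have T0 : 0 < T by rewrite ltr0n.
have [m disp] := uniform_displacement T.
pose C : R := m.+1%:R.
have C1 : 1 <= C by rewrite ler1n.
have ln2 : 0 < ln 2 :> R by rewrite ln_gt0// ltr1n.
(* With this rate, exp (s / b) = 2 ^ (s / T), which is at most 2 up to time [T]. *)
pose b := T / ln 2.
have b0 : 0 < b by rewrite divr_gt0.
have e2 s : s <= T -> expR (s / b) <= 2.
  move=> sT; rewrite -[leRHS]lnK ?posrE// ler_expR ler_pdivrMr//.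
  by rewrite /b mulrC divfK ?gt_eqF.
(* Induction on an integer bound for t. Up to time [T], [growth_ge] and the displacement bound give
   2 <= 16 C growth. Beyond [T], a doubling time s >= 1 lowers the bound by one, and growth x s > 2
   pays for exp (s / b) <= 2. *)
have claim k x t : tY x -> 0 <= t <= k%:R -> expR (t / b) <= 16 * C * growth x t.
  elim: k x t => [|k IH] x t Yx /andP[t0 tk]; have [tT|Tt] := leP t T.
  - apply: (le_trans (e2 _ tT)).
    have := growth_ge _ t Yx; have := growth_gt0 _ t Yx.
    have : hcosh x (tPhi t x) <= C.
      by rewrite (le_trans (disp x t _)) ?t0// ler_nat.
    by nra.
  - by have := lt_le_trans Tt tk; rewrite ltNge (ltW T0).
  - apply: (le_trans (e2 _ tT)).
    have := growth_ge _ t Yx; have := growth_gt0 _ t Yx.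
    have : hcosh x (tPhi t x) <= C.
      by rewrite (le_trans (disp x t _)) ?t0// ler_nat.
    by nra.
  have [s /andP[s1 sn] gs] := doubling x Yx.
  have sT : s <= T by rewrite (le_trans sn)// ler_nat.
  have := IH (tPhi s x) (t - s) (lift_invariant s _ Yx).
  have -> : 0 <= t - s <= k%:R.
    by rewrite subr_ge0 (le_trans sT (ltW Tt))/=; rewrite -natr1 in tk; lra.
  move=> /(_ isT) IHs.
  have -> : t / b = s / b + (t - s) / b by field; rewrite gt_eqF.
  rewrite expRD -[X in growth _ X](subrK s) growthD//.
  have := e2 _ sT; have := expR_gt0 ((t - s) / b).
  have := growth_gt0 _ (t - s) (lift_invariant s _ Yx).
  by move=> g0 e0 es; nra.
(* Here 128 is 16 times the factor 8 of [growth_le]. *)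
exists b, (128 * C); split=> //; first lra.
move=> x t Yx t0.
have tb : 0 <= t <= (Num.bound t)%:R by rewrite t0 ltW// archi_boundP.
apply: (le_trans (claim _ _ _ Yx tb)).
by have := growth_le _ t Yx; nra.
Qed.

End Growth.

(** * From exponential growth to the quasigeodesic inequality *)

Theorem theorem1p4 (R : realType) (M : topologicalType)
    (G : set (H3 R -> H3 R)) (p : H3 R -> M)
    (hM : closed_hyperbolic_3manifold G p)
    (Phi : R -> M -> M) (hPhi : is_flow Phi)
    (tPhi : R -> H3 R -> H3 R) (htPhi : lifted_flow p Phi tPhi)
    (V : H3 R -> 'rV[R]_3) (hV : generated_by tPhi V)
    (hunit : arclength_parametrized V)
    (Y : set M) (Y_closed : closed Y) (Y_inv : flow_invariant Phi Y)
    (ha : half_orbits_converge tPhi (p @^-1` Y))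
    (hb : forall x, (p @^-1` Y) x -> eta_plus tPhi x <> eta_minus tPhi x)
    (hc_plus : {within p @^-1` Y, continuous (eta_plus tPhi)})
    (hc_minus : {within p @^-1` Y, continuous (eta_minus tPhi)}) :
  uniformly_quasigeodesic tPhi (p @^-1` Y).
Proof.
have [b [c [b0 c1 growth]]] :=
  exponential_growth hM htPhi Y_closed Y_inv ha hb hc_minus.
have c0 : 0 < c by exact: lt_le_trans c1.
have lnc : 0 <= ln c by rewrite ln_ge0.
have bound x t : (p @^-1` Y) x -> 0 <= t -> t <= b * (ln c + hdist x (tPhi t x)).
  move=> Yx t0; rewrite mulrC -ler_pdivrMr//.
  have h0 : 0 < hcosh x (tPhi t x) by exact: lt_le_trans (hcosh_ge1 _ _).
  apply: (@le_trans _ _ (ln (c * hcosh x (tPhi t x)))).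
    by rewrite -ler_expR lnK ?posrE ?mulr_gt0// growth.
  by rewrite lnM ?posrE// lerD2l ln_hcosh_le.
have hdist_ge0 (x y : H3 R) : 0 <= hdist x y.
  by rewrite (le_trans _ (ln_hcosh_le x y))// ln_ge0// hcosh_ge1.
(* This k exceeds both the slope b and the intercept b ln c; the final 1 makes the inequality
   strict. *)
have k0 : 0 < b * (ln c + 1) + 1 by rewrite ltr_wpDl// mulr_ge0 ?addr_ge0// ltW.
exists (b * (ln c + 1) + 1) => // z Yz x y [u _ <-] _ t ->.
set x' := tPhi u z.
have Yx : (p @^-1` Y) x' by exact: (lift_invariant htPhi Y_inv).
have lin d : 0 <= d -> b * (ln c + d) < (b * (ln c + 1) + 1) * d + (b * (ln c + 1) + 1).
  by move=> d0; have := mulr_ge0 (ltW b0) lnc; nra.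
apply: le_lt_trans (lin _ (hdist_ge0 _ _)).
have [t0|t0] := leP 0 t; first by rewrite ger0_norm//; exact: bound.
(* For negative t the endpoints are exchanged: x' is reached from x'.t in the positive time -t. *)
rewrite ltr0_norm// hdistC.
have {2}-> : x' = tPhi (- t) (tPhi t x').
  by rewrite -(flowD (proj1 htPhi)) addNr (flow0 (proj1 htPhi)).
by apply: bound; [exact: (lift_invariant htPhi Y_inv)|rewrite oppr_ge0 ltW].
Qed.
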